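(* Let $p\ge 1$ and let $\mathfrak g$ be a $(2p+1)$-dimensional Lie algebra over $\mathbb K$ ($\mathbb K=\mathbb R$ or $\mathbb C$) isomorphic to a linear deformation $\mu_0+t\varphi_1$ ($t\neq0$) of the Heisenberg algebra $\mathfrak h_{2p+1}=(V,\mu_0)$, where, in the classical basis $\{X_1,\dots,X_{2p+1}\}$ of $\mathfrak h_{2p+1}$, the skew-symmetric bilinear map $\varphi_1:V\times V\to V$ satisfies $\varphi_1(X_i,X_j)\in\mathrm{span}\{X_1,\dots,X_{2p}\}$ for $1\le i,j\le 2p$ and $\varphi_1(X_i,X_{2p+1})=0$ for $1\le i\le 2p$. Then $\mathfrak g$ is a central extension of a $2p$-dimensional symplectic Lie algebra by its symplectic form.
   Context: The Heisenberg algebra $\mathfrak h_{2p+1}=(V,\mu_0)$ has classical basis $X_1,\dots,X_{2p+1}$ with $\mu_0(X_{2k-1},X_{2k})=X_{2p+1}$ for $k=1,\dots,p$, all other brackets of basis vectors (not following by skew-symmetry) being zero. A linear deformation of $\mathfrak h_{2p+1}$ is a Lie bracket $\mu=\mu_0+t\varphi_1$ on $V$ with $\varphi_1$ skew-symmetric bilinear, with the Jacobi identity holding identically in $t$; equivalently $\delta_{\mu_0}\varphi_1=0$ ($\varphi_1$ is a Chevalley–Eilenberg $2$-cocycle of $\mathfrak h_{2p+1}$ with values in the adjoint module) and $\varphi_1\circ\varphi_1=0$, where $\varphi\circ\psi(X,Y,Z)=\varphi(\psi(X,Y),Z)+\varphi(\psi(Y,Z),X)+\varphi(\psi(Z,X),Y)$.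 A symplectic Lie algebra is a $2p$-dimensional Lie algebra $\mathfrak k$ with a nondegenerate skew-symmetric bilinear form $\theta$ satisfying $\theta([X,Y],Z)+\theta([Y,Z],X)+\theta([Z,X],Y)=0$ for all $X,Y,Z$. The central extension of $\mathfrak k$ by $\theta$ is $\mathfrak k\oplus\mathbb K Z$ with bracket $[X,Y]=[X,Y]_{\mathfrak k}+\theta(X,Y)Z$ for $X,Y\in\mathfrak k$, and $Z$ central. *)

(* Defs.v *)
From mathcomp Require Import all_boot all_order all_algebra.
From mathcomp Require Import sesquilinear.
From mathcomp Require Import reals complex.

Set Implicit Arguments.
Unset Strict Implicit.
Unset Printing Implicit Defensive.

Import GRing.Theory.
Local Open Scope ring_scope.

Definition real_or_complex_field (R : realType) (K : fieldType) : Prop :=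
  K = (R : fieldType) \/ K = (R[i] : fieldType).

Definition skew_bilinear (K : fieldType) (V W : vectType K) (f : V -> V -> W) :
    Prop :=
  bilinear_for *:%R *:%R f /\ (forall x y, f x y = - f y x).

(* With f and g both V -> V -> V this is the product f o g; it is also used with
   a form f : V -> V -> K^o. *)
Definition circ (K : fieldType) (V W : vectType K)
    (f : V -> V -> W) (g : V -> V -> V) (x y z : V) : W :=
  f (g x y) z + f (g y z) x + f (g z x) y.

Definition jacobi (K : fieldType) (V : vectType K) (br : V -> V -> V) : Prop :=
  forall x y z, circ br br x y z = 0.

Definition lie_bracket (K : fieldType) (V : vectType K) (br : V -> V -> V) :
    Prop :=
  skew_bilinear br /\ jacobi br.

Definition lie_isomorphic (K : fieldType) (V W : vectType K)
    (br : V -> V -> V) (br' : W -> W -> W) : Prop :=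
  exists f : {linear V -> W},
    bijective f /\ (forall x y, f (br x y) = br' (f x) (f y)).

(* Indices are shifted by one: X`_i is the basis vector X_(i+1), so the centre
   is spanned by X`_(2p) and the nonzero brackets are those of X`_(2k) and
   X`_(2k+1) with k < p. *)
Definition heisenberg_bracket (K : fieldType) (V : vectType K) (p : nat)
    (X : (p.*2.+1).-tuple V) (mu0 : V -> V -> V) : Prop :=
  [/\ basis_of fullv X,
      skew_bilinear mu0,
      forall k, (k < p)%N -> mu0 X`_(k.*2) X`_(k.*2.+1) = X`_(p.*2)
    & forall i j, (i < j < p.*2.+1)%N ->
        ~ (exists k, [/\ (k < p)%N, i = k.*2 & j = k.*2.+1]) ->
        mu0 X`_i X`_j = 0].

Definition deformed_bracket (K : fieldType) (V : vectType K)
    (mu0 phi : V -> V -> V) (t : K) (x y : V) : V :=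
  mu0 x y + t *: phi x y.

(* Over an infinite field, "identically in t" amounts to "for every scalar t". *)
Definition linear_deformation (K : fieldType) (V : vectType K)
    (mu0 phi : V -> V -> V) : Prop :=
  skew_bilinear phi /\ (forall t : K, jacobi (deformed_bracket mu0 phi t)).

Definition nondegenerate_form (K : fieldType) (V : vectType K)
    (theta : V -> V -> K^o) : Prop :=
  forall x, (forall y, theta x y = 0) -> x = 0.

Definition symplectic_form (K : fieldType) (k : vectType K)
    (br : k -> k -> k) (theta : k -> k -> K^o) : Prop :=
  [/\ skew_bilinear theta,
      nondegenerate_form theta
    & forall x y z, circ theta br x y z = 0].

Definition central_extension_bracket (K : fieldType) (k : vectType K)
    (br : k -> k -> k) (theta : k -> k -> K^o) (x y : (k * K^o)%type) :
    (k * K^o)%type :=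
  (br x.1 y.1, theta x.1 y.1).

Definition central_extension_of_symplectic (K : fieldType) (n : nat)
    (g : vectType K) (br : g -> g -> g) : Prop :=
  exists (k : vectType K) (brk : k -> k -> k) (theta : k -> k -> K^o),
    [/\ \dim {:k} = n,
        lie_bracket brk,
        symplectic_form brk theta
      & lie_isomorphic br (central_extension_bracket brk theta)].

(* Main.v *)
(** Let Z = X_(2p+1) and U = span (X_1, ..., X_(2p)).  Both mu0 and phi1 kill Z,
    mu0 takes its values in the line of Z and phi1 maps U x U to U.  Hence in the
    decomposition V = U + K Z the bracket mu0 + t phi1 has U-component t phi1 and
    Z-component the form theta given by mu0.  The Jacobi identity splits
    accordingly: its U-component is the Jacobi identity of t phi1 on U, and its
    Z-component says that theta is closed.  Finally theta is nondegenerate, since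
    X_1, ..., X_(2p) is a Darboux basis for it. *)
Require Import Defs.
From HB Require Import structures.
From mathcomp Require Import all_boot all_order all_algebra.
From mathcomp Require Import sesquilinear.
From mathcomp Require Import reals complex.

Set Implicit Arguments.
Unset Strict Implicit.
Unset Printing Implicit Defensive.

Import GRing.Theory.
Local Open Scope ring_scope.

Lemma real_or_complex_two_neq0 (R : realType) (K : fieldType) :
  real_or_complex_field R K -> 2 != 0 :> K.
Proof. by case=> ->; rewrite Num.Theory.pnatr_eq0. Qed.

(** Turns skew-symmetry, given as [f x y = - f y x], into [f x x = 0]. *)
Lemma eq_opp_self0 (K : fieldType) (V : lmodType K) (x : V) :
  2 != 0 :> K -> x = - x -> x = 0.
Proof.
move=> two_neq0 xN; apply/eqP; have : 2 *: x == 0.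
  by rewrite scaler_nat mulr2n {2}xN subrr.
by rewrite scaler_eq0 (negPf two_neq0).
Qed.

Section Spans.
Variable K : fieldType.

(** The preimage of [U] is a subspace. With [U] the zero space, this reduces vanishing to spanning
    vectors. *)
Lemma linear_span (V W : vectType K) (f : {linear V -> W}) (s : seq V)
    (U : {vspace W}) :
  {in s, forall x, f x \in U} -> {in <<s>>%VS, forall x, f x \in U}.
Proof.
move=> fs x; have /subvP : (<<s>> <= linfun f @^-1: U)%VS.
  by apply/span_subvP => y /fs fy; rewrite -memv_preim lfunE.
by move=> /[apply]; rewrite -memv_preim lfunE.
Qed.

Lemma bilinear_span (V V' W : vectType K) (f : {bilinear V -> V' -> W})
    (s : seq V) (s' : seq V') (U : {vspace W}) :
  {in s & s', forall x y, f x y \in U} ->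
  {in <<s>>%VS & <<s'>>%VS, forall x y, f x y \in U}.
Proof.
move=> fs x y xs; apply: linear_span => {}y ys.
change (applyr f y x \in U).
by apply: linear_span xs => {}x xs; apply: fs.
Qed.

Lemma bilinear_full_span (V V' W : vectType K) (f : {bilinear V -> V' -> W})
    (s : seq V) (s' : seq V') (U : {vspace W}) :
  <<s>>%VS = fullv -> <<s'>>%VS = fullv ->
  {in s & s', forall x y, f x y \in U} -> forall x y, f x y \in U.
Proof.
by move=> ss ss' fs x y; apply: (bilinear_span fs); rewrite ?ss ?ss' memvf.
Qed.

(** Packs a bare function into the bilinear structure, so that the generic linearity lemmas apply to
    it. *)
Lemma skew_bilinearP (V W : vectType K) (f : V -> V -> W) :
  skew_bilinear f ->
  exists2 F : {bilinear V -> V -> W}, f = F & forall x y, F x y = - F y x.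
Proof.
case=> lf sf.
pose F : {bilinear V -> V -> W} := HB.pack f (bilinear_isBilinear.Build K V V W
  (GRing.Scale.Law.clone K W *:%R _) (GRing.Scale.Law.clone K W *:%R _) f lf).
by exists F.
Qed.

Lemma coord_basis_last (V : vectType K) n (X : n.+1.-tuple V) :
  basis_of fullv X -> coord X ord_max X`_n = 1.
Proof. by move/basis_free => fX; rewrite (coord_free ord_max) // eqxx. Qed.

Lemma mem_span_take (V : vectType K) n (X : n.+1.-tuple V) i :
  (i < n)%N -> X`_i \in <<take n X>>%VS.
Proof.
move=> lt_in; apply: memv_span; rewrite -(nth_take _ lt_in) mem_nth //.
by rewrite size_takel // size_tuple.
Qed.

Lemma span_take_coord (V : vectType K) n (X : n.+1.-tuple V) x :
  basis_of fullv X ->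
  (x \in <<take n X>>%VS) = (coord X ord_max x == 0).
Proof.
move=> bX; apply/idP/idP => [xU|/eqP x0].
  rewrite -(memv0 (coord X ord_max x : K^o)).
  apply: (@linear_span V K^o (coord X ord_max)) xU => {}x.
  case/(nthP 0) => i; rewrite size_takel ?size_tuple // => lt_in <-.
  rewrite nth_take // memv0.
  have /= -> := coord_free (widen_ord (leqnSn n) (Ordinal lt_in)) ord_max
                           (basis_free bX).
  by rewrite -val_eqE /= ltn_eqF.
rewrite (coord_basis bX (memvf x)) big_ord_recr /= x0 scale0r addr0.
by apply: memv_suml => i _; rewrite memvZ // mem_span_take.
Qed.

End Spans.

Section Heisenberg.
Variables (K : fieldType) (V : vectType K) (p : nat).
Variables (X : (p.*2.+1).-tuple V) (mu0 : V -> V -> V).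
Hypotheses (two_neq0 : 2 != 0 :> K) (hmu0 : heisenberg_bracket X mu0).

Lemma heisenberg_derived x y : mu0 x y \in <[X`_(p.*2)]>%VS.
Proof.
case: hmu0 => bX /skew_bilinearP[f muf skf] mupair mu_0; move: mupair mu_0.
rewrite muf => mupair mu_0.
have fX i j : (i < j < p.*2.+1)%N -> f X`_i X`_j \in <[X`_(p.*2)]>%VS.
  (* Quantifying over ['I_p] makes the Darboux-pair condition boolean, hence open to case
     analysis. *)
  move=> ij; case: (boolP [exists k : 'I_p, (i == k.*2) && (j == k.*2.+1)]).
    by case/existsP=> k /andP[/eqP-> /eqP->]; rewrite mupair // memv_line.
  move/existsP => nk; rewrite mu_0 ?mem0v // => -[k [kp ik jk]].
  by apply: nk; exists (Ordinal kp); rewrite ik jk /= !eqxx.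
apply: bilinear_full_span (span_basis bX) (span_basis bX) _ x y.
move=> _ _ /(nthP 0)[i ip <-] /(nthP 0)[j jp <-].
rewrite !size_tuple in ip jp; case: (ltngtP i j) => ij.
- by rewrite fX // ij.
- by rewrite skf memvN fX // ij.
- by rewrite ij (eq_opp_self0 two_neq0 (skf _ _)) mem0v.
Qed.

Lemma heisenberg_center x : mu0 x X`_(p.*2) = 0.
Proof.
case: hmu0 => bX /skew_bilinearP[f muf skf] _; rewrite muf => mu_0.
apply/eqP; rewrite -memv0; change (applyr f X`_(p.*2) x \in 0%VS).
have: x \in <<X>>%VS by rewrite (span_basis bX) memvf.
apply: linear_span => {x} _ /(nthP 0)[i ip <-]; rewrite memv0 /=; apply/eqP.
move: ip; rewrite size_tuple ltnS leq_eqVlt => /predU1P[->|ip].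
  exact: eq_opp_self0 (skf _ _).
(* In a Darboux pair the second index is odd, whereas [p.*2] is even. *)
rewrite /= /applyr mu_0 ?ip //= => -[k [kp _ ke]].
by have := congr1 odd ke; rewrite /= !odd_double.
Qed.

(** Bracketing [u] with the Darboux partner of a basis vector isolates, up to sign, the coordinate
    of [u] along that vector; the last coordinate vanishes by membership in the span. *)
Lemma heisenberg_nondegenerate u :
  u \in <<take p.*2 X>>%VS ->
  (forall j, (j < p.*2)%N -> mu0 u X`_j = 0) -> u = 0.
Proof.
case: hmu0 => bX /skew_bilinearP[f muf skf]; rewrite muf => mupair mu_0 uU uX.
(* The half of an index names its Darboux block, since [k.*2] and [k.*2.+1] both have half [k];
   distinct blocks commute. *)
have fX i j : (i < p.*2.+1)%N -> (j < p.*2.+1)%N -> i./2 != j./2 ->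
    f X`_i X`_j = 0.
  have f0 i' j' : (i' < j' < p.*2.+1)%N -> i'./2 != j'./2 -> f X`_i' X`_j' = 0.
    move=> ij ne; apply: mu_0 ij _ => -[k [_ ei ej]].
    by move: ne; rewrite ei ej /= uphalf_double doubleK eqxx.
  move=> ip jp ne; case: (ltngtP i j) => ij; last by rewrite ij eqxx in ne.
    by rewrite f0 ?ij.
  by rewrite skf f0 ?oppr0 ?ij // eq_sym.
have Z0 : X`_(p.*2) != 0.
  apply/eqP => Z0; have := coord_basis_last bX.
  by rewrite Z0 linear0 => /eqP; rewrite eq_sym oner_eq0.
rewrite (coord_basis bX (memvf u)); apply: big1 => i _.
suff -> : coord X i u = 0 by rewrite scale0r.
have fu j : f u X`_j = \sum_(i < p.*2.+1) coord X i u *: f X`_i X`_j.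
  rewrite {1}(coord_basis bX (memvf u)).
  by rewrite linear_sumlz; apply: eq_bigr => k _; rewrite linearZl_LR.
have [ip|ip] := ltnP i p.*2; last first.
  have -> : i = ord_max by apply/val_inj/eqP; rewrite eqn_leq -ltnS ltn_ord.
  by apply/eqP; rewrite -span_take_coord.
have kp : (i./2 < p)%N by rewrite ltn_half_double.
have ei := odd_double_half i.
(* The partner of X_i in the Darboux basis is X_j, where {i, j} = {2k, 2k+1}. *)
pose j := (~~ odd i + i./2.*2)%N.
have jhalf : j./2 = i./2 by rewrite half_bit_double.
have jp : (j < p.*2)%N by rewrite -ltn_half_double jhalf.
(* Only the term at [i] survives: the other index of its block is [j] itself, and the other blocks
   commute with [X_j]. *)
have /eqP := uX j jp; rewrite fu (bigD1 i) //= big1 ?addr0; last first.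
  move=> i' ni'; have ni : (i' : nat) != i by [].
  have [ij|nij] := eqVneq i'./2 i./2; last by rewrite fX ?jhalf ?scaler0 // ltnW.
  have -> : (i' : nat) = j.
    move: ni; rewrite -{1}ei -(odd_double_half i') ij /j eqn_add2r.
    by case: (odd i) (odd i') => [] [].
  by rewrite (eq_opp_self0 two_neq0 (skf _ _)) scaler0.
rewrite scaler_eq0 => /predU1P[//|]; rewrite /j -{1}ei.
case: (odd i); rewrite /= ?add1n ?add0n; last by rewrite mupair // (negPf Z0).
by rewrite skf mupair // oppr_eq0 (negPf Z0).
Qed.

End Heisenberg.

Theorem theorem15 (R : realType) (K : fieldType)
  (hK : real_or_complex_field R K) (p : nat) (hp : (1 <= p)%N)
  (g : vectType K) (br : g -> g -> g)
  (hdim : \dim {:g} = p.*2.+1) (hbr : lie_bracket br)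
  (V : vectType K) (X : (p.*2.+1).-tuple V) (mu0 phi1 : V -> V -> V)
  (hmu0 : heisenberg_bracket X mu0)
  (hphi1 : linear_deformation mu0 phi1)
  (t : K) (ht : t != 0)
  (hiso : lie_isomorphic br (deformed_bracket mu0 phi1 t))
  (hspan : forall i j : nat, (i < p.*2)%N -> (j < p.*2)%N ->
     phi1 X`_i X`_j \in <<take p.*2 X>>%VS)
  (hcenter : forall i : nat, (i < p.*2)%N -> phi1 X`_i X`_(p.*2) = 0) :
  central_extension_of_symplectic p.*2 br.
Proof.
have two_neq0 := real_or_complex_two_neq0 hK.
have muZ := heisenberg_center two_neq0 hmu0.
have mu_line := heisenberg_derived two_neq0 hmu0.
have mu_nondeg := heisenberg_nondegenerate two_neq0 hmu0.
case: hmu0 => bX /skew_bilinearP[mu muE skmu] _ _.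
case: hphi1 => /skew_bilinearP[phi phiE skphi] jac.
subst mu0 phi1.
set Z := X`_(p.*2) in muZ mu_line hcenter.
set U := <<take p.*2 X>>%VS in mu_nondeg hspan.
pose c : {linear V -> K^o} := coord X ord_max.
have cZ : c Z = 1 by apply: (coord_basis_last bX).
have inU x : (x \in U) = (c x == 0) by apply: (span_take_coord x bX).
(* [hcenter] covers the basis vectors before [Z]; skew-symmetry covers [Z] itself. *)
have phiZ x : phi x Z = 0.
  apply/eqP; rewrite -memv0; change (applyr phi Z x \in 0%VS).
  have: x \in <<X>>%VS by rewrite (span_basis bX) memvf.
  apply: linear_span => {x} _ /(nthP 0)[i ip <-]; rewrite memv0 /=; apply/eqP.
  move: ip; rewrite size_tuple ltnS leq_eqVlt => /predU1P[->|/hcenter//].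
  exact: eq_opp_self0 (skphi _ _).
have phiU : {in U & U, forall x y, phi x y \in U}.
  apply: bilinear_span => _ _ /(nthP 0)[i ip <-] /(nthP 0)[j jp <-].
  move: ip jp; rewrite !size_takel ?size_tuple // => ip jp.
  by rewrite !nth_take //; exact: hspan.
have mu_c x y : mu x y = c (mu x y) *: Z.
  by have /vlineP[a ->] := mu_line x y; rewrite linearZ /= cZ [_ *: 1]mulr1.
(* By [phiU] the argument of [vsproj] already lies in [U], so the projection only changes its
   type. *)
pose brk (u v : subvs_of U) := vsproj U (t *: phi (vsval u) (vsval v)).
pose theta (u v : subvs_of U) : K^o := c (mu (vsval u) (vsval v)).
(* [F] splits [x] along the sum of [U] and the line of [Z]; [G] reassembles the two components. *)
pose F x : subvs_of U * K^o := (vsproj U (x - c x *: Z), c x).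
pose G (w : subvs_of U * K^o) : V := vsval w.1 + w.2 *: Z.
have cG w : c (G w) = w.2.
  have /eqP wU : c (vsval w.1) == 0 by rewrite -inU subvsP.
  by rewrite linearD linearZ /= wU cZ add0r [_ *: 1]mulr1.
have FK : cancel F G.
  move=> x; rewrite /G /F /= vsprojK ?subrK // inU linearB linearZ /= cZ.
  by rewrite [_ *: 1]mulr1 subrr.
have GK : cancel G F.
  by move=> [u a]; rewrite /F cG /G /= addrK vsvalK.
have Flin : linear F.
  move=> a x y; congr (_, _); last exact: linearP.
  rewrite /F /= -linearP; congr (vsproj U _).
  by rewrite linearP scalerBr scalerDl scalerA opprD addrACA.
pose br' := deformed_bracket mu phi t.
pose ext := central_extension_bracket brk theta.
have brG w w' : br' (G w) (G w') = G (ext w w').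
  (* A skew map killing [Z] depends only on the [U]-components; this applies to both [mu] and
     [phi]. *)
  have proj (f : {bilinear V -> V -> V}) : (forall x, f x Z = 0) ->
      (forall x y, f x y = - f y x) -> f (G w) (G w') = f (vsval w.1) (vsval w'.1).
    move=> fZ fN; rewrite /G linearDr linearZr_LR /= fZ scaler0 addr0.
    by rewrite linearDl linearZl_LR /= [f Z _]fN fZ oppr0 scaler0 addr0.
  rewrite /br' /deformed_bracket !proj // /G /= vsprojK.
    by rewrite -mu_c addrC.
  by rewrite memvZ // phiU // subvsP.
have Fbr x y : F (br' x y) = ext (F x) (F y).
  by rewrite -{1}(FK x) -{1}(FK y) brG GK.
have brk_skew : skew_bilinear brk.
  split; first split.
  - by move=> v a u u'; rewrite /brk -linearP linearPl scalerDr !scalerA mulrC.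
  - by move=> u a v v'; rewrite /brk -linearP linearPr scalerDr !scalerA mulrC.
  - by move=> u v; rewrite /brk skphi scalerN linearN.
have theta_skew : skew_bilinear theta.
  split; first split.
  - by move=> v a u u'; rewrite /theta -linearP linearPl.
  - by move=> u a v v'; rewrite /theta -linearP linearPr.
  - by move=> u v; rewrite /theta skmu linearN.
pose Flinear : {linear V -> (subvs_of U * K^o)%type} :=
  HB.pack F (GRing.isLinear.Build K V (subvs_of U * K^o)%type *:%R F Flin).
have FE : F =1 Flinear by [].
(* The Jacobi identity of the deformation is transported along the linear bijection [F]. *)
have ext_jac u v w : circ ext ext u v w = 0.
  rewrite -(GK u) -(GK v) -(GK w) /circ -!Fbr !FE -!linearD.
  rewrite -[RHS](linear0 Flinear); congr (Flinear _).
  exact: jac.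
(* The two components of the Jacobi identity of [ext], read on the lifts [(u, 0)], [(v, 0)],
   [(w, 0)]. *)
have brk_theta_jac (u v w : subvs_of U) :
  circ brk brk u v w = 0 /\ circ theta brk u v w = 0.
  have jac0 := ext_jac (u, 0) (v, 0) (w, 0).
  by split; [exact (congr1 fst jac0) | exact (congr1 snd jac0)].
exists (subvs_of U), brk, theta; split.
- rewrite dimvf -[LHS]/(\dim U); move: (basis_free bX).
  rewrite -{1}(cat_take_drop p.*2 X) => /catl_free/eqP ->.
  by rewrite size_takel // size_tuple.
- by split=> // u v w; case: (brk_theta_jac u v w).
- split=> // [u th0|u v w]; last by case: (brk_theta_jac u v w).
  apply: val_inj; apply: mu_nondeg (subvsP u) _ => j jp.
  (* Viewed as an element of [U], [X_j] is a legitimate argument of [theta], which gives the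
     [Z]-coordinate of the bracket. *)
  rewrite mu_c -[X in mu _ X](@vsprojK _ _ U) ?mem_span_take //.
  by rewrite -/(theta u _) th0 scale0r.
- case: hiso => h [hbij hbr'].
  exists (Flinear \o h); split; first by apply: bij_comp => //; exists G.
  by move=> x y; rewrite /= hbr'; exact: Fbr.
Qed.
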